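(* Let $\mathbf a=(a_n)_{n\ge1}$ be a sequence of natural numbers (the value $0$ being allowed) that is uniformly behaved in $\mathbb N$ and completely additive. Then $\mathbf a$ is square-free uniformly behaved in $\mathbb N$; that is, for every real $0<\theta<1$, $$\lim_{N\to\infty}\frac1N\sum_{n=1}^{N}\mu^2(n)e^{2\pi i a_n\theta}=0.$$
   Context: $\mathbf a$ is uniformly behaved in $\mathbb N$ if for every real $0<\theta<1$, $\lim_{N\to\infty}\frac1N\sum_{n=1}^N e^{2\pi i a_n\theta}=0$. $\mathbf a$ is completely additive if $a_{mn}=a_m+a_n$ for all $m,n\ge1$. $\mu$ is the Möbius function, so $\mu^2$ is the indicator function of the set of square-free positive integers. *)

(* Defs.v *)
From mathcomp Require Import all_boot all_order all_algebra.
From mathcomp Require Import complex.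
From mathcomp Require Import all_classical all_reals all_analysis.

Set Implicit Arguments.
Unset Strict Implicit.
Unset Printing Implicit Defensive.

Import Order.TTheory GRing.Theory Num.Theory.
Import numFieldNormedType.Exports.

Local Open Scope classical_set_scope.
Local Open Scope ring_scope.
Local Open Scope complex_scope.

Definition square_free (n : nat) : bool :=
  (0 < n)%N && [forall d : 'I_n.+1, (d ^ 2 %| n)%N ==> (d == 1 :> nat)].

Definition moebius (n : nat) : int :=
  if square_free n then (-1) ^+ size (primes n) else 0.

(* e^{it} for real t; the library has no complex exponential. *)
Definition expi (R : realType) (t : R) : R[i] := cos t +i* sin t.

(* Sequences are indexed by the integers n >= 1: a 0 is a junk value, and
   no definition below depends on it. *)
Definition completely_additive (a : nat -> nat) : Prop :=
  forall m n : nat, (1 <= m)%N -> (1 <= n)%N -> a (m * n)%N = (a m + a n)%N.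

(* The library puts no topology on R[i] itself; on the regular module R[i]^o
   it is the one given by the modulus. *)
Definition uniformly_behaved (R : realType) (a : nat -> nat) : Prop :=
  forall theta : R, 0 < theta -> theta < 1 ->
    (fun N : nat => N%:R^-1 *
       \sum_(1 <= n < N.+1) expi (2 * pi * (a n)%:R * theta))
    @ \oo --> (0 : R[i]^o).

Definition square_free_uniformly_behaved (R : realType) (a : nat -> nat)
    : Prop :=
  forall theta : R, 0 < theta -> theta < 1 ->
    (fun N : nat => N%:R^-1 *
       \sum_(1 <= n < N.+1)
         (moebius n ^+ 2)%:~R * expi (2 * pi * (a n)%:R * theta))
    @ \oo --> (0 : R[i]^o).

(* Main.v *)
Require Import Defs.
From mathcomp Require Import all_boot all_order all_algebra.
From mathcomp Require Import complex zify ring.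
From mathcomp Require Import all_classical all_reals all_analysis.

Set Implicit Arguments.
Unset Strict Implicit.
Unset Printing Implicit Defensive.

Import Order.TTheory GRing.Theory Num.Theory.
Import numFieldNormedType.Exports.

Local Open Scope ring_scope.

(** Fix [theta] and put [g n = exp (2 pi i a_n theta)].  Complete additivity
    makes [g] completely multiplicative, so [g (p^2 m) = c_p g m] for every
    prime [p], with [c_p = g (p^2)] of modulus 1.  The hypothesis says
    that the mean of [g] is zero, and the square-free numbers are reached by
    removing the multiples of [4, 9, 25, ...] one prime at a time.

    Let [S_D N] be the sum of [g] over the [n <= N] that are divisible by no
    [p^2] with [p < D] prime.  For a prime [p], the terms of [S_p] that
    [S_(p+1)] loses are those with [n = p^2 m]; since [p^2 m] and [m] are
    divisible by the same squares of primes below [p],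
    [S_(p+1) N = S_p N - c_p S_p (N / p^2)]  ([sum_sieve_step]).  Hence, by
    induction on [D], each [S_D N] is [o(N)]  ([mean_zero_sifted]).

    What survives the sieve up to [k] without being square-free is divisible
    by [d^2] for some [d > k], and there are at most
    [sum_(d > k) N / d^2 <= N / k] such numbers up to [N]
    ([count_sifted_non_square_free]).  So the square-free sum is within [N / k]
    of an [o(N)], for every [k], and is itself [o(N)]
    ([mean_zero_square_free]). *)

(** * Sieving by the squares of small primes *)

Definition sifted (D n : nat) : bool :=
  [forall p : 'I_D, prime p ==> ~~ (p ^ 2 %| n)%N].

Lemma siftedP D n :
  reflect (forall p, (p < D)%N -> prime p -> ~~ (p ^ 2 %| n)%N) (sifted D n).
Proof.
apply: (iffP forallP) => [H p ltpD pr_p | H p].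
  exact: (implyP (H (Ordinal ltpD))).
by apply/implyP; apply: H.
Qed.

Lemma sifted0 n : sifted 0 n.
Proof. by apply/siftedP. Qed.

Lemma siftedS D n :
  sifted D.+1 n = sifted D n && (prime D ==> ~~ (D ^ 2 %| n)%N).
Proof.
apply/siftedP/andP => [H | [/siftedP H /implyP HD] p].
  split; last by apply/implyP; apply: H.
  by apply/siftedP => p ltpD; apply: H; apply: ltnW.
by rewrite ltnS leq_eqVlt => /orP[/eqP-> | ]; [apply: HD | apply: H].
Qed.

(** For a prime [q < p], [q^2] is coprime to [p^2].  This is why primes are
    sifted in increasing order and each exactly once. *)
Lemma sifted_mul_prime_sq p m : prime p -> sifted p (p ^ 2 * m) = sifted p m.
Proof.
move=> pr_p; apply: eq_forallb => -[q /= ltqp].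
case pr_q: (prime q) => //=; rewrite Gauss_dvdr // coprimeXl ?coprimeXr //.
by rewrite prime_coprime // dvdn_prime2 // ltn_eqF.
Qed.

Lemma square_free_sifted D n : square_free n -> sifted D n.
Proof.
case/andP=> n_gt0 /forallP sf; apply/siftedP => p _ pr_p; apply/negP => pn.
have ltpn : (p < n.+1)%N.
  rewrite ltnS (leq_trans _ (dvdn_leq n_gt0 pn)) //.
  by rewrite -{1}(expn1 p) leq_exp2l ?prime_gt1.
by have := implyP (sf (Ordinal ltpn)) pn => /= /eqP p1; rewrite p1 in pr_p.
Qed.

(** If [d^2] divides [n] with [d > 1], so does the square of any prime factor
    of [d]; the sieve forces that prime to be at least [D]. *)
Lemma sifted_non_square_free D n : (0 < n)%N -> sifted D n ->
  ~~ square_free n -> exists2 d, (D <= d <= n)%N & (d ^ 2 %| n)%N.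
Proof.
move=> n_gt0 /siftedP siftn; rewrite /square_free n_gt0 /= negb_forall.
case/existsP=> -[d ltdn]; rewrite negb_imply /= => /andP[dn d1].
have pn : (pdiv d ^ 2 %| n)%N.
  by rewrite (dvdn_trans _ dn) // dvdn_exp2r ?pdiv_dvd.
(* [d = 0] is excluded because 0 divides only 0. *)
have d_gt0 : (0 < d)%N by case: (d) dn => //; rewrite dvd0n; lia.
exists (pdiv d) => //; apply/andP; split; last first.
  by rewrite (leq_trans (pdiv_leq d_gt0)).
rewrite leqNgt; apply/negP => lt_pD.
by move: pn; apply/negP/siftn => //; apply: pdiv_prime; lia.
Qed.

(** * Sums over sifted numbers *)

Lemma sum_multiples (V : nmodType) (h : nat -> V) (q N : nat) : (0 < q)%N ->
  \sum_(1 <= n < N.+1 | (q %| n)%N) h n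
  = \sum_(1 <= m < (N %/ q).+1) h (q * m)%N.
Proof.
move=> q_gt0; elim: N => [|N IHN]; first by rewrite div0n !big_geq.
rewrite big_mkcond big_nat_recr //= -big_mkcond IHN divnS //.
case: ifP => [qN|_] /=; last by rewrite addr0.
rewrite add1n [RHS]big_nat_recr //=; congr (_ + h _).
by rewrite -[LHS](divnK qN) divnS // qN mulnC.
Qed.

(** The mean of [g] over [P] tends to 0, with the tolerances [1 / k] and
    denominators cleared: in this form it makes sense over a field that is not
    known to be archimedean. *)
Definition mean_zero (K : numFieldType) (P : pred nat) (g : nat -> K) : Prop :=
  forall k : nat, exists N0 : nat, forall N : nat, (N0 <= N)%N ->
    k%:R * `|\sum_(1 <= n < N.+1 | P n) g n| <= N%:R.

(** Sifting by [p] removes the multiples [p^2 m], where [m] and [p^2 m] pass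
    the earlier stages together. *)
Lemma sum_sieve_step (K : nzRingType) (g : nat -> K) (c : K) p N : prime p ->
  (forall m, (0 < m)%N -> g (p ^ 2 * m)%N = c * g m) ->
  \sum_(1 <= n < N.+1 | sifted p.+1 n) g n
  = \sum_(1 <= n < N.+1 | sifted p n) g n
    - c * \sum_(1 <= n < (N %/ p ^ 2).+1 | sifted p n) g n.
Proof.
move=> pr_p gp.
have -> : \sum_(1 <= n < N.+1 | sifted p n) g n
        = \sum_(1 <= n < N.+1 | (p ^ 2 %| n)%N) (if sifted p n then g n else 0)
          + \sum_(1 <= n < N.+1 | sifted p.+1 n) g n.
  rewrite (bigID (fun n => (p ^ 2 %| n)%N)) /=; congr (_ + _).
    by rewrite -big_mkcondr; apply: eq_bigl => n; rewrite andbC.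
  by apply: eq_bigl => n; rewrite siftedS pr_p.
rewrite sum_multiples ?expn_gt0 ?prime_gt0 //; set M := (X in X + _ - _).
suff -> : M = c * \sum_(1 <= m < (N %/ p ^ 2).+1 | sifted p m) g m.
  by rewrite addrAC subrr add0r.
rewrite {}/M big_distrr /= [RHS]big_mkcond.
rewrite big_nat [RHS]big_nat; apply: eq_bigr => m /andP[m_gt0 _].
by rewrite sifted_mul_prime_sq // gp.
Qed.

Lemma mean_zero_sifted (K : numFieldType) (g : nat -> K) (c : nat -> K) :
  (forall p, prime p -> `|c p| <= 1) ->
  (forall p m, prime p -> (0 < m)%N -> g (p ^ 2 * m)%N = c p * g m) ->
  mean_zero predT g -> forall D, mean_zero (sifted D) g.
Proof.
move=> c1 gc g0; elim=> [|D IHD] k.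
  have [N0 HN0] := g0 k; exists N0 => N /HN0; apply: le_trans.
  by rewrite (eq_bigl predT) // => n; rewrite sifted0.
have [prD|nprD] := boolP (prime D); last first.
  have [N0 HN0] := IHD k; exists N0 => N /HN0; apply: le_trans.
  by rewrite (eq_bigl (sifted D)) // => n; rewrite siftedS (negbTE nprD) andbT.
have D2 : (0 < D ^ 2)%N by rewrite expn_gt0 prime_gt0.
(* The two sums of the sieve step share the tolerance N / k equally; N must be
   so large that the shorter one, up to N / D^2, is small as well. *)
have [N0 HN0] := IHD (k * 2)%N.
exists (N0 * D ^ 2)%N => N leN.
rewrite (sum_sieve_step _ prD (fun m => gc D m prD)).
set S := \sum_(_ <= _ < N.+1 | _) _; set T := \sum_(_ <= _ < _ | _) _.
have SN : (k * 2)%:R * `|S| <= N%:R.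
  by apply: HN0; rewrite (leq_trans _ leN) ?leq_pmulr.
have TN : (k * 2)%:R * `|T| <= N%:R.
  by rewrite (le_trans (HN0 _ _)) ?leq_divRL ?ler_nat ?leq_div.
rewrite -(ler_pM2r (ltr0n K 2)) -[_ * _ * 2%:R]mulrAC -natrM mulr_natr mulr2n.
apply: le_trans (lerD SN TN); rewrite -mulrDr ler_wpM2l //.
by rewrite (le_trans (ler_normB _ _)) // lerD2l normrM ler_piMl ?c1.
Qed.

(** * Numbers that survive the sieve without being square-free *)

(** Compare [1 / d^2] with [1 / (d - 1) - 1 / d] and telescope. *)
Lemma sum_inv_sq_tail (K : numFieldType) (k M : nat) : (0 < k)%N ->
  k%:R * \sum_(k.+1 <= d < M) (d ^ 2)%:R^-1 <= 1 :> K.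
Proof.
move=> k_gt0; have k0 : 0 < k%:R :> K by rewrite ltr0n.
rewrite -ler_pdivlMl // mulr1; have [leMk|ltkM] := leqP M k.+1.
  by rewrite big_geq // invr_ge0 ler0n.
case: M ltkM => // M; rewrite ltnS => ltkM.
rewrite big_add1 /=.
apply: (@le_trans _ _ (\sum_(k <= d < M) ((- d.+1%:R^-1) - (- d%:R^-1)))).
  rewrite big_nat [leRHS]big_nat; apply: ler_sum => d /andP[ltkd _].
  have d_gt0 : (0 < d)%N by apply: leq_trans ltkd.
  have d0 : d%:R != 0 :> K by rewrite pnatr_eq0 -lt0n.
  have d10 : 1 + d%:R != 0 :> K by rewrite nat1r pnatr_eq0.
  have -> : - d.+1%:R^-1 - - d%:R^-1 = (d * d.+1)%:R^-1 :> K.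
    by rewrite natrM -nat1r; field; rewrite d0 d10.
  by rewrite lef_pV2 ?posrE ?ltr0n ?ler_nat ?muln_gt0 ?expn_gt0 ?d_gt0 //; lia.
by rewrite telescope_sumr ?(ltnW ltkM) // opprK addrC gerBl invr_ge0 ler0n.
Qed.

(** Union bound over the square divisors [d^2] with [k < d <= N]; there are at
    most [N / d^2] multiples of [d^2] up to [N]. *)
Lemma count_sifted_non_square_free (K : numFieldType) (k N : nat) : (0 < k)%N ->
  k%:R * \sum_(1 <= n < N.+1 | sifted k.+1 n && ~~ square_free n) 1
  <= N%:R :> K.
Proof.
move=> k_gt0.
apply: (@le_trans _ _ (k%:R * \sum_(1 <= n < N.+1)
    \sum_(k.+1 <= d < N.+1 | (d ^ 2 %| n)%N) 1)).
  apply: ler_wpM2l; rewrite // big_mkcond big_nat [leRHS]big_nat.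
  apply: ler_sum => n /andP[n_gt0 ltnN].
  case: ifP => [/andP[siftn nsf]|_]; last exact: sumr_ge0.
  have [d /andP[led ldn] dn] := sifted_non_square_free n_gt0 siftn nsf.
  rewrite big_mkcond (bigD1_seq d) ?iota_uniq //=; last first.
    by rewrite mem_index_iota led (leq_ltn_trans ldn).
  by rewrite dn lerDl sumr_ge0 // => i _; case: ifP.
rewrite (exchange_big_dep xpredT) //=.
have count_le : forall d, (k < d)%N ->
    \sum_(1 <= n < N.+1 | (d ^ 2 %| n)%N) 1 <= N%:R * (d ^ 2)%:R^-1 :> K.
  move=> d ltkd; have d0 : (0 < d ^ 2)%N by rewrite expn_gt0 (leq_trans _ ltkd).
  rewrite sum_multiples // sumr_const_nat subn1 /= ler_pdivlMr ?ltr0n //.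
  by rewrite -natrM ler_nat leq_divM.
apply: (@le_trans _ _ (k%:R * \sum_(k.+1 <= d < N.+1) (N%:R * (d ^ 2)%:R^-1))).
  apply: ler_wpM2l; rewrite // big_nat [leRHS]big_nat.
  by apply: ler_sum => d /andP[ltkd _]; apply: count_le.
by rewrite -big_distrr /= mulrCA ler_piMr ?ler0n ?sum_inv_sq_tail.
Qed.

(** The sifted sum is [o(N)] for each fixed depth, and the error made by
    stopping at depth [j] is at most [N / j] uniformly in [N]. *)
Lemma mean_zero_square_free (K : numFieldType) (g : nat -> K) (c : nat -> K) :
  (forall n, `|g n| <= 1) -> (forall p, prime p -> `|c p| <= 1) ->
  (forall p m, prime p -> (0 < m)%N -> g (p ^ 2 * m)%N = c p * g m) ->
  mean_zero predT g -> mean_zero square_free g.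
Proof.
move=> g1 c1 gc g0 [|k]; first by exists 0%N => N _; rewrite mul0r ler0n.
(* At this depth the sieve error is at most half of the tolerance
   [N / k.+1]. *)
set j := (k.+1 * 2)%N.
have [N0 HN0] := mean_zero_sifted c1 gc g0 j.+1 j.
exists N0 => N /HN0 SN.
set B := \sum_(1 <= n < N.+1 | sifted j.+1 n && ~~ square_free n) g n.
have splitS : \sum_(1 <= n < N.+1 | sifted j.+1 n) g n
            = \sum_(1 <= n < N.+1 | square_free n) g n + B.
  rewrite (bigID square_free) /=; congr (_ + _); apply: eq_bigl => n.
  by rewrite andb_idl //; apply: square_free_sifted.
have BN : j%:R * `|B| <= N%:R.
  apply: le_trans (@count_sifted_non_square_free K j N isT).
  by rewrite ler_wpM2l // (le_trans (ler_norm_sum _ _ _)) // ler_sum.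
rewrite -(ler_pM2r (ltr0n K 2)) -[_ * _ * 2%:R]mulrAC -natrM mulr_natr mulr2n.
apply: le_trans (lerD SN BN); rewrite -mulrDr ler_wpM2l //.
rewrite splitS; set Q := \sum_(_ <= _ < _ | square_free _) _.
by rewrite -{1}(addrK B Q) ler_normB.
Qed.

(** * Exponential sums *)

Local Open Scope complex_scope.
Local Open Scope classical_set_scope.

(** A positive element of [R[i]] is real, so the archimedean property of [R]
    applies to it. *)
Lemma complex_inv_nat_le (R : realType) (e : R[i]) : 0 < e ->
  exists k : nat, (0 < k)%N && (k%:R^-1 <= e).
Proof.
case: e => x y; rewrite ltcE /= => /andP[/eqP-> x_gt0].
exists (Num.truncn x^-1).+1; rewrite ltn0Sn /=.
have -> : (Num.truncn x^-1).+1%:R^-1 = ((Num.truncn x^-1).+1%:R^-1 : R)%:C.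
  by rewrite fmorphV rmorph_nat.
rewrite lecR invf_ple ?posrE ?ltr0n //; apply/ltW/truncnS_gt.
Qed.

Lemma mean_zeroP (R : realType) (P : pred nat) (g : nat -> R[i]) :
  (fun N : nat => N%:R^-1 * \sum_(1 <= n < N.+1 | P n) g n)
    @ \oo --> (0 : R[i]^o)
  <-> mean_zero P g.
Proof.
pose f N : R[i]^o := N%:R^-1 * \sum_(1 <= n < N.+1 | P n) g n.
have [f_dist dist_f] := @cvgrPdist_le R[i] (R[i]^o) nat \oo _ f 0.
split=> [/f_dist H k | H].
(* The tolerance [1 / k.+1] rather than [1 / k], since [k] may be 0. *)
- have k0 : 0 < k.+1%:R^-1 :> R[i] by rewrite invr_gt0 ltr0n.
  have [N0 _ HN0] := H _ k0; exists N0.+1 => N ltN.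
  have /= := HN0 N (ltnW ltN); rewrite sub0r normrN normrM normfV normr_nat.
  rewrite ler_pdivrMl ?ltr0n ?(leq_trans _ ltN) // ler_pdivlMr ?ltr0n //.
  by apply: le_trans; rewrite mulrC ler_wpM2l ?ler_nat.
- apply: dist_f => e /complex_inv_nat_le[k /andP[k_gt0 ke]].
  have [N0 HN0] := H k; exists N0.+1 => // N /= ltN.
  rewrite sub0r normrN normrM normfV normr_nat (le_trans _ ke) //.
  rewrite ler_pdivrMl ?ltr0n ?(leq_trans _ ltN) // ler_pdivlMr ?ltr0n //.
  by rewrite mulrC HN0 // ltnW.
Qed.

Lemma moebius_sqr n : moebius n ^+ 2 = (square_free n)%:R.
Proof.
by rewrite /moebius; case: ifP => _; rewrite ?expr0n // sqrr_sign.
Qed.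

Lemma expiD (R : realType) (s t : R) : expi (s + t) = expi s * expi t.
Proof. by rewrite /expi cosD sinD /=; simpc; rewrite [sin s * _ + _]addrC. Qed.

Lemma norm_expi (R : realType) (t : R) : `|expi t| = 1.
Proof. by rewrite normc_def /= cos2Dsin2 sqrtr1. Qed.

Theorem theorem6 (R : realType) (a : nat -> nat)
    (a_unif : uniformly_behaved R a)
    (a_add : completely_additive a) :
  square_free_uniformly_behaved R a.
Proof.
move=> theta theta_gt0 theta_lt1.
pose g n : R[i] := expi (2 * pi * (a n)%:R * theta).
have -> : (fun N : nat => N%:R^-1 *
       \sum_(1 <= n < N.+1)
         (moebius n ^+ 2)%:~R * expi (2 * pi * (a n)%:R * theta)) =
   (fun N : nat => N%:R^-1 * \sum_(1 <= n < N.+1 | square_free n) g n).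
  apply/funext => N; congr (_ * _); rewrite [RHS]big_mkcond.
  apply: eq_bigr => n _; rewrite moebius_sqr.
  by case: (square_free n); rewrite ?mul1r ?mul0r.
apply/mean_zeroP/(@mean_zero_square_free _ g (fun p => g (p ^ 2)%N)).
- by move=> n; rewrite norm_expi.
- by move=> p _; rewrite norm_expi.
- move=> p m pr_p m_gt0; rewrite /g a_add ?expn_gt0 ?(prime_gt0 pr_p) //.
  by rewrite -expiD natrD mulrDr mulrDl.
- by apply/mean_zeroP; apply: a_unif.
Qed.
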